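(* Let $D$ be a finitely generated free abelian group and let $A$ be a $D$-graded ring generated over $A_0$ by a set $\{a_1,\dots,a_n\}$ of homogeneous elements such that any $\mathbb{Z}$-linearly independent subset of $\{\deg a_1,\dots,\deg a_n\}$ having $\operatorname{rank}D$ elements is a basis of the abelian group $D$. Then there is a collection $F$ of relevant elements of $A$ such that $\operatorname{Proj}_{\mathrm{MH}}A=\bigcup_{f\in F}\operatorname{Spec}A_{(f)}$ and, for each $f\in F$, $\{d\in D : d=\deg g\text{ for some homogeneous } g\in A_f^\times\}=D$. Hence the points of $\operatorname{Proj}_{\mathrm{MH}}A$ correspond to homogeneous prime ideals of $A$, i.e. for every point $p\in\operatorname{Proj}_{\mathrm{MH}}A$ the associated homogeneous ideal $I_p\subset A$ is prime.
   Context: All rings are commutative with $1$. Let $D$ be a finitely generated abelian group. A $D$-graded ring $B$ is periodic if the subgroup $\{d\in D : \exists\, g\in B_d\cap B^\times\}$ has finite index in $D$. A homogeneous element $f$ of a $D$-graded ring $A$ is relevant if the localization $A_f$ (with its induced $D$-grading) is periodic; $A_{(f)}$ denotes the degree $0$ part of $A_f$. The grading corresponds to an action of the diagonalizable group scheme $\operatorname{Spec}A_0[D]$ on $\operatorname{Spec}A$; let $Q$ be the quotient in the category of ringed spaces. For relevant $f$ one has an open subspace $D_+(f)=\operatorname{Spec}A_{(f)}\subset Q$, and $\operatorname{Proj}_{\mathrm{MH}}A=\bigcup_{f\text{ relevant}}D_+(f)\subset Q$, which is a scheme. Ideals attached to points. Each point $p\in\operatorname{Proj}_{\mathrm{MH}}A$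 corresponds to a homogeneous ideal $I_p\subset A$, in general not prime, such that the homogeneous elements of $A\setminus I_p$ form a multiplicatively closed set. Explicitly, if $p\in D_+(f)=\operatorname{Spec}A_{(f)}$ is given by a prime $P\subset A_{(f)}$, then a homogeneous $a\in A$ lies in $I_p$ if and only if $a^n/g\in P$, where $n\ge 1$ is such that there is a homogeneous unit $g\in A_f^\times$ with $\deg g=n\deg a$ (independently of the choices of $f,n,g$). *)

(* Defs.v *)
From HB Require Import structures.
From Stdlib Require Import Relation_Operators Operators_Properties.
From mathcomp Require Import all_boot all_order all_algebra.
From mathcomp Require Import finmap boolp classical_sets.
From mathcomp Require Import ring zify.
From mathcomp Require Import monalg.

Set Implicit Arguments.
Unset Strict Implicit.
Unset Printing Implicit Defensive.

Import GRing.Theory.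
Local Open Scope classical_set_scope.
Local Open Scope ring_scope.
Local Open Scope quotient_scope.

(* Rings are [comPzRingType]s, so that the zero ring is allowed: the
   localization at a nilpotent element is one. *)

Record is_prime_ideal (R : comPzRingType) (I : set R) : Prop := IsPrimeIdeal {
  prime_ideal0 : I 0;
  prime_idealD : forall x y, I x -> I y -> I (x + y);
  prime_idealMl : forall a x, I x -> I (a * x);
  prime_ideal1 : ~ I 1;
  prime_idealM : forall x y, I (x * y) -> I x \/ I y }.

Record Spec (R : comPzRingType) := MkSpec {
  spec_ideal :> set R;
  spec_prime : is_prime_ideal spec_ideal }.

HB.instance Definition _ (R : comPzRingType) := gen_eqMixin (Spec R).
HB.instance Definition _ (R : comPzRingType) := gen_choiceMixin (Spec R).

Lemma preimage_prime_ideal (R S : comPzRingType) (phi : {rmorphism R -> S})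
  (y : Spec S) : is_prime_ideal (phi @^-1` y).
Proof.
have [y0 yD yMl y1 yM] := spec_prime y.
split=> /= [|u v yu yv|a u yu||u v].
- by rewrite rmorph0.
- by rewrite rmorphD; apply: yD.
- by rewrite rmorphM; apply: yMl.
- by rewrite rmorph1.
- by rewrite rmorphM => /yM.
Qed.

Definition Spec_map (R S : comPzRingType) (phi : {rmorphism R -> S})
  (y : Spec S) : Spec R := MkSpec (preimage_prime_ideal phi y).

Section Localization.
Variables (A : comPzRingType) (f : A).

Definition loc_eq (u v : A * nat) : bool :=
  `[< exists k, f ^+ (k + v.2) * u.1 = f ^+ (k + u.2) * v.1 >].

Lemma loc_eq_equiv : equiv_class_of loc_eq.
Proof.
split=> [[a m]|[a m] [b n]|[b n] [a m] [c p]].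
- by apply/asboolP; exists 0%N.
- by apply/asboolP/asboolP => -[k e]; exists k.
- move=> /asboolP[k /= e1] /asboolP[l /= e2]; apply/asboolP => /=.
  exists (k + l + n)%N; rewrite !exprD in e1 e2 *.
  transitivity (f ^+ l * f ^+ p * (f ^+ k * f ^+ n * a)); first by ring.
  rewrite e1; transitivity (f ^+ k * f ^+ m * (f ^+ l * f ^+ p * b)).
    by ring.
  by rewrite e2; ring.
Qed.

Canonical loc_eq_equiv_rel := EquivRelPack loc_eq_equiv.

Definition loc : Type := {eq_quot loc_eq}.
HB.instance Definition _ := Choice.on loc.
HB.instance Definition _ := EqQuotient.on loc.

(* The fraction a / f^k. *)
Definition frac (a : A) (k : nat) : loc := \pi_loc (a, k).

Lemma fracE a m b n :
  frac a m = frac b n <-> exists k, f ^+ (k + n) * a = f ^+ (k + m) * b.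
Proof.
split; first by move=> /eqquotP/asboolP.
by move=> h; apply/eqquotP/asboolP.
Qed.

Lemma fracP (x : loc) : exists a k, x = frac a k.
Proof.
by exists (repr x).1, (repr x).2; rewrite /frac -surjective_pairing reprK.
Qed.

Let nm (x : loc) := (repr x).1.
Let dn (x : loc) := (repr x).2.
Lemma nmdn x : frac (nm x) (dn x) = x.
Proof. by rewrite /frac -surjective_pairing reprK. Qed.

Definition loc_add (x y : loc) : loc :=
  frac (nm x * f ^+ dn y + nm y * f ^+ dn x) (dn x + dn y).
Definition loc_mul (x y : loc) : loc := frac (nm x * nm y) (dn x + dn y).
Definition loc_opp (x : loc) : loc := frac (- nm x) (dn x).

Lemma frac_add a m b n :
  loc_add (frac a m) (frac b n) = frac (a * f ^+ n + b * f ^+ m) (m + n).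
Proof.
have /fracE[k e1] := nmdn (frac a m); have /fracE[l e2] := nmdn (frac b n).
apply/fracE; exists (k + l)%N.
move: (nm (frac a m)) (dn (frac a m)) (nm (frac b n)) (dn (frac b n)) e1 e2
  => a' m' b' n' e1 e2.
rewrite !exprD in e1 e2 *.
transitivity (f ^+ l * f ^+ n * f ^+ n' * (f ^+ k * f ^+ m * a')
  + f ^+ k * f ^+ m * f ^+ m' * (f ^+ l * f ^+ n * b')); first by ring.
by rewrite e1 e2; ring.
Qed.

Lemma frac_mul a m b n :
  loc_mul (frac a m) (frac b n) = frac (a * b) (m + n).
Proof.
have /fracE[k e1] := nmdn (frac a m); have /fracE[l e2] := nmdn (frac b n).
apply/fracE; exists (k + l)%N.
move: (nm (frac a m)) (dn (frac a m)) (nm (frac b n)) (dn (frac b n)) e1 e2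
  => a' m' b' n' e1 e2.
rewrite !exprD in e1 e2 *.
transitivity ((f ^+ k * f ^+ m * a') * (f ^+ l * f ^+ n * b')); first by ring.
by rewrite e1 e2; ring.
Qed.

Lemma frac_opp a m : loc_opp (frac a m) = frac (- a) m.
Proof.
have /fracE[k e] := nmdn (frac a m); apply/fracE; exists k.
by rewrite !mulrN e.
Qed.

Lemma loc_addA : associative loc_add.
Proof.
move=> x y z; have [[a [m ->]] [b [n ->]]] := (fracP x, fracP y).
have [c [p ->]] := fracP z; rewrite !frac_add addnA; congr frac.
by rewrite !exprD; ring.
Qed.
Lemma loc_addC : commutative loc_add.
Proof.
move=> x y; have [[a [m ->]] [b [n ->]]] := (fracP x, fracP y).
by rewrite !frac_add addrC addnC.
Qed.
Lemma loc_add0 : left_id (frac 0 0) loc_add.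
Proof.
move=> x; have [a [m ->]] := fracP x.
by rewrite frac_add mul0r add0r mulr1.
Qed.
Lemma loc_addN : left_inverse (frac 0 0) loc_opp loc_add.
Proof.
move=> x; have [a [m ->]] := fracP x.
rewrite frac_opp frac_add; apply/fracE; exists 0%N.
by rewrite mulNr addNr !mulr0.
Qed.
HB.instance Definition _ :=
  GRing.isZmodule.Build loc loc_addA loc_addC loc_add0 loc_addN.

Lemma loc_mulA : associative loc_mul.
Proof.
move=> x y z; have [[a [m ->]] [b [n ->]]] := (fracP x, fracP y).
by have [c [p ->]] := fracP z; rewrite !frac_mul addnA mulrA.
Qed.
Lemma loc_mulC : commutative loc_mul.
Proof.
move=> x y; have [[a [m ->]] [b [n ->]]] := (fracP x, fracP y).
by rewrite !frac_mul mulrC addnC.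
Qed.
Lemma loc_mul1 : left_id (frac 1 0) loc_mul.
Proof.
by move=> x; have [a [m ->]] := fracP x; rewrite frac_mul mul1r.
Qed.
Lemma loc_mulDl : left_distributive loc_mul +%R.
Proof.
move=> x y z; have [[a [m ->]] [b [n ->]]] := (fracP x, fracP y).
have [c [p ->]] := fracP z; rewrite /GRing.add /= !(frac_add, frac_mul).
by apply/fracE; exists 0%N; rewrite !exprD; ring.
Qed.
HB.instance Definition _ := GRing.Zmodule_isComPzRing.Build loc
  loc_mulA loc_mulC loc_mul1 loc_mulDl.

Lemma fracD a m b n :
  frac a m + frac b n = frac (a * f ^+ n + b * f ^+ m) (m + n).
Proof. exact: frac_add. Qed.
Lemma fracM a m b n : frac a m * frac b n = frac (a * b) (m + n).
Proof. exact: frac_mul. Qed.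
Lemma fracN a m : - frac a m = frac (- a) m.
Proof. exact: frac_opp. Qed.
Lemma frac0 m : frac 0 m = 0.
Proof. by apply/fracE; exists 0%N; rewrite !mulr0. Qed.
Lemma frac_eq0 a m : frac a m = 0 <-> exists k, f ^+ k * a = 0.
Proof.
split=> [/fracE[k]|[k fka]]; first by rewrite addn0 mulr0; exists k.
by apply/fracE; exists k; rewrite addn0 mulr0.
Qed.
Lemma fracDr a b m : frac a m + frac b m = frac (a + b) m.
Proof. by rewrite fracD; apply/fracE; exists 0%N; rewrite !exprD; ring. Qed.
Lemma frac_expand a m k : frac a m = frac (f ^+ k * a) (m + k).
Proof. by apply/fracE; exists 0%N; rewrite !exprD; ring. Qed.

Definition locmap (a : A) : loc := frac a 0.

Lemma locmap_is_zmod_morphism : zmod_morphism locmap.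
Proof. by move=> a b; rewrite /locmap fracN fracDr. Qed.
Lemma locmap_is_monoid_morphism : monoid_morphism locmap.
Proof. by split=> // a b; rewrite /locmap fracM. Qed.
HB.instance Definition _ :=
  GRing.isZmodMorphism.Build A loc locmap locmap_is_zmod_morphism.
HB.instance Definition _ :=
  GRing.isMonoidMorphism.Build A loc locmap locmap_is_monoid_morphism.
End Localization.

(* [malg] supplies finitely supported functions with their additive structure;
   its multiplication cannot be used, as it requires a monoid of exponents
   without nontrivial units. [<< a *g d >>] is the term a X^d. *)
Definition grpalg (D : zmodType) (A : comPzRingType) : Type := {malg A[D]}.

Section GroupAlgebra.
Variables (D : zmodType) (A : comPzRingType).
Local Notation AD := (grpalg D A).
Implicit Types u v w : {malg A[D]}.

HB.instance Definition _ := GRing.Zmodule.on AD.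

Definition gmul u v : {malg A[D]} :=
  \sum_(d <- msupp u) \sum_(e <- msupp v) << u@_d * v@_e *g d + e >>.

Lemma gmulw (s t : {fset D}) u v :
  (msupp u `<=` s)%fset -> (msupp v `<=` t)%fset ->
  gmul u v = \sum_(d <- s) \sum_(e <- t) << u@_d * v@_e *g d + e >>.
Proof.
move=> us vt; rewrite /gmul (big_fset_incl _ us) /=.
  apply/eq_bigr=> d _; apply/big_fset_incl => // e _ /mcoeff_outdom ->.
  by rewrite mulr0 monalgU0.
move=> d _ /mcoeff_outdom ud.
by rewrite big1 => // e _; rewrite ud mul0r monalgU0.
Qed.

Lemma gmulC : commutative gmul.
Proof.
move=> u v; rewrite /gmul exchange_big; apply/eq_bigr=> d _; apply/eq_bigr=> e _.
by rewrite mulrC addrC.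
Qed.

Lemma gmulDl : left_distributive gmul +%R.
Proof.
move=> u v w.
rewrite (gmulw (msuppD_le u v) (fsubset_refl _)).
rewrite (gmulw (fsubsetUl _ (msupp v)) (fsubset_refl (msupp w))).
rewrite (gmulw (fsubsetUr (msupp u) _) (fsubset_refl (msupp w))).
rewrite -big_split /=; apply/eq_bigr=> d _; rewrite -big_split /=.
by apply/eq_bigr=> e _; rewrite mcoeffD mulrDl monalgUD.
Qed.

Lemma gmulDr : right_distributive gmul +%R.
Proof. by move=> u v w; rewrite ![gmul u _]gmulC gmulDl. Qed.

Lemma gmul0 : left_zero 0 gmul.
Proof. by move=> u; rewrite /gmul msupp0 big_seq_fset0. Qed.

Lemma gmul0r : right_zero 0 gmul.
Proof. by move=> u; rewrite gmulC gmul0. Qed.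

Lemma gmul_suml I (r : seq I) (F : I -> {malg A[D]}) v :
  gmul (\sum_(i <- r) F i) v = \sum_(i <- r) gmul (F i) v.
Proof. by rewrite (big_morph (gmul^~ v) (fun x y => gmulDl x y v) (gmul0 v)). Qed.

Lemma gmul_sumr I (r : seq I) (F : I -> {malg A[D]}) v :
  gmul v (\sum_(i <- r) F i) = \sum_(i <- r) gmul v (F i).
Proof. by rewrite (big_morph (gmul v) (gmulDr v) (gmul0r v)). Qed.

Lemma gmulUU a b d e :
  gmul << a *g d >> << b *g e >> = << a * b *g d + e >>.
Proof. by rewrite (gmulw msuppU_le msuppU_le) !big_seq_fset1 !mcoeffUU. Qed.

Lemma gmulA : associative gmul.
Proof.
move=> u v w; rewrite [u]monalgE [v]monalgE [w]monalgE.
rewrite !gmul_suml; apply/eq_bigr=> d _.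
rewrite [LHS]gmul_sumr [X in gmul X _]gmul_sumr gmul_suml.
apply/eq_bigr=> e _; rewrite !gmul_sumr; apply/eq_bigr=> c _.
by rewrite !gmulUU mulrA addrA.
Qed.

Lemma gmul1 : left_id << 1 *g 0 >> gmul.
Proof.
move=> u; rewrite {1}[u]monalgE gmul_sumr [RHS]monalgE.
by apply/eq_bigr=> d _; rewrite gmulUU mul1r add0r.
Qed.

HB.instance Definition _ := GRing.Zmodule_isComPzRing.Build AD
  gmulA gmulC gmul1 gmulDl.

Definition grpalgC (a : A) : AD := << a *g 0 >>.

Lemma grpalgC_is_zmod_morphism : zmod_morphism grpalgC.
Proof. by move=> a b; exact: (monalgUB (K := D) 0 a b). Qed.
Lemma grpalgC_is_monoid_morphism : monoid_morphism grpalgC.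
Proof. by split=> // a b; rewrite /GRing.mul /= /grpalgC gmulUU addr0. Qed.
HB.instance Definition _ :=
  GRing.isZmodMorphism.Build A AD grpalgC grpalgC_is_zmod_morphism.
HB.instance Definition _ :=
  GRing.isMonoidMorphism.Build A AD grpalgC grpalgC_is_monoid_morphism.

Definition msum u : A := \sum_(d <- msupp u) u@_d.

Lemma msumw (s : {fset D}) u : (msupp u `<=` s)%fset ->
  msum u = \sum_(d <- s) u@_d.
Proof. by move=> us; apply: big_fset_incl => // d _ /mcoeff_outdom. Qed.

Lemma msumD : {morph msum : u v / u + v}.
Proof.
move=> u v; rewrite (msumw (msuppD_le u v)).
rewrite (msumw (fsubsetUl _ (msupp v))) (msumw (fsubsetUr (msupp u) _)).
by rewrite -big_split; apply/eq_bigr=> d _; rewrite mcoeffD.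
Qed.

Lemma msum0 : msum 0 = 0.
Proof. by rewrite /msum msupp0 big_seq_fset0. Qed.

Lemma msumU a d : msum << a *g d >> = a.
Proof. by rewrite (msumw msuppU_le) big_seq_fset1 mcoeffUU. Qed.

Lemma msum_sum I (r : seq I) (F : I -> {malg A[D]}) :
  msum (\sum_(i <- r) F i) = \sum_(i <- r) msum (F i).
Proof. by rewrite (big_morph msum msumD msum0). Qed.

Lemma msumN u : msum (- u) = - msum u.
Proof. by apply/eqP; rewrite -addr_eq0 -msumD addNr msum0. Qed.

Lemma msumM u v : msum (gmul u v) = msum u * msum v.
Proof.
rewrite /gmul msum_sum mulr_suml; apply/eq_bigr=> d _.
by rewrite msum_sum mulr_sumr; apply/eq_bigr=> e _; rewrite msumU.
Qed.
End GroupAlgebra.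

(* A finitely supported family [c : {malg A[D]}] with c_d in the piece of
   degree d is a homogeneous decomposition of [msum c]; the last two fields
   say that A is the direct sum of its pieces. *)
Record grading (D : zmodType) (A : comPzRingType) := Grading {
  piece :> D -> set A;
  piece0 : forall d, piece d 0;
  pieceB : forall d x y, piece d x -> piece d y -> piece d (x - y);
  piece1 : piece 0 1;
  pieceM : forall d e x y, piece d x -> piece e y -> piece (d + e) (x * y);
  piece_span : forall x, exists c : {malg A[D]},
    (forall d, piece d c@_d) /\ msum c = x;
  piece_direct : forall c : {malg A[D]},
    (forall d, piece d c@_d) -> msum c = 0 -> c = 0 }.

Section Graded.
Variables (D : zmodType) (A : comPzRingType) (gr : grading D A).

Lemma pieceN d x : gr d x -> gr d (- x).
Proof. by move=> dx; rewrite -[- x]add0r; apply: pieceB => //; apply: piece0. Qed.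

Lemma pieceD d x y : gr d x -> gr d y -> gr d (x + y).
Proof. by move=> dx dy; rewrite -[y]opprK; apply: pieceB => //; apply: pieceN. Qed.

Lemma piece_sum I (r : seq I) (F : I -> A) d :
  (forall i, gr d (F i)) -> gr d (\sum_(i <- r) F i).
Proof.
move=> dF; elim/big_rec: _ => [|i x _]; first exact: piece0.
by apply: pieceD.
Qed.

Lemma pieceX d x k : gr d x -> gr (d *+ k) (x ^+ k).
Proof.
move=> dx; elim: k => [|k IHk]; first exact: piece1.
by rewrite mulrS exprS; apply: pieceM.
Qed.

(* The coaction a |-> sum_d a_d X^d defining the action of the diagonalizable
   group scheme Spec A_0[D] on Spec A. *)
Definition coact (a : A) : grpalg D A := projT1 (cid (piece_span gr a)).

Definition hcomp (d : D) (a : A) : A := mcoeff d (coact a).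

Lemma hcompP d a : gr d (hcomp d a).
Proof. by rewrite /hcomp /coact; case: cid => c [/= cd _]. Qed.

Lemma msum_coact a : msum (coact a) = a.
Proof. by rewrite /coact; case: cid => c []. Qed.

Lemma piece_uniq (u v : {malg A[D]}) : (forall d, gr d u@_d) ->
  (forall d, gr d v@_d) -> msum u = msum v -> u = v.
Proof.
move=> du dv uv; apply/eqP; rewrite -subr_eq0; apply/eqP.
apply: (piece_direct (g := gr)) => [d|]; first by rewrite mcoeffB; apply: pieceB.
by rewrite msumD msumN uv subrr.
Qed.

Lemma pieceU d a e : gr d a -> gr e (<< a *g d >>@_e).
Proof.
move=> da; rewrite mcoeffU; case: eqP => [<-|_] /=; rewrite ?mulr1n //.
exact: piece0.
Qed.

Lemma coact_homog d a : gr d a -> coact a = << a *g d >>.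
Proof.
move=> da; apply: piece_uniq => [e|e|]; first exact: hcompP.
  exact: pieceU.
by rewrite msum_coact msumU.
Qed.

Lemma coact_is_zmod_morphism : zmod_morphism coact.
Proof.
move=> a b; apply: piece_uniq => [d|d|]; first exact: hcompP.
  by rewrite mcoeffB; apply: pieceB; apply: hcompP.
by rewrite msumD msumN !msum_coact.
Qed.

Lemma coact_is_monoid_morphism : monoid_morphism coact.
Proof.
split=> [|a b]; first by rewrite (coact_homog (piece1 gr)).
apply: piece_uniq => [d|d|]; first exact: hcompP.
  rewrite {1}/GRing.mul /= /gmul raddf_sum; apply: piece_sum => i.
  rewrite raddf_sum; apply: piece_sum => j; apply: pieceU.
  by apply: pieceM; apply: hcompP.
by rewrite {2}/GRing.mul /= msumM !msum_coact.
Qed.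

HB.instance Definition _ :=
  GRing.isZmodMorphism.Build A (grpalg D A) coact coact_is_zmod_morphism.
HB.instance Definition _ :=
  GRing.isMonoidMorphism.Build A (grpalg D A) coact coact_is_monoid_morphism.

Definition in_deg0 : {pred A} := fun x => `[< gr 0 x >].

Lemma in_deg0_closed : subring_closed in_deg0.
Proof.
split=> [|x y /asboolP x0 /asboolP y0|x y /asboolP x0 /asboolP y0].
- exact/asboolP/piece1.
- exact/asboolP/pieceB.
- by apply/asboolP; rewrite -[0]addr0; apply: pieceM.
Qed.

Record deg0 := Deg0 { deg0val :> A; deg0valP : deg0val \in in_deg0 }.
HB.instance Definition _ := [isSub for deg0val].
HB.instance Definition _ := [Choice of deg0 by <:].
HB.instance Definition _ :=
  GRing.SubChoice_isSubComPzRing.Build A in_deg0 deg0 in_deg0_closed.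

Definition unit_degrees : set D :=
  [set d | exists g : A, gr d g /\ (exists h, g * h = 1)].

Definition finite_index (H : set D) : Prop :=
  exists s : seq D, forall d, exists2 c, c \in s & H (d - c).

Definition periodic : Prop := finite_index unit_degrees.

Definition homogeneous_ideal (I : set A) : Prop :=
  forall a, I a -> forall d, I (hcomp d a).
End Graded.

(* Homogeneous elements come with a degree, which matters for 0 only. *)
Record homog (D : zmodType) (A : comPzRingType) (gr : grading D A) := Homog {
  hval :> A;
  hdeg : D;
  hvalP : gr hdeg hval }.

Section HomogeneousLocalization.
Variables (D : zmodType) (A : comPzRingType) (gr : grading D A) (f : homog gr).
Local Notation e := (hdeg f).
Local Notation Af := (loc (hval f)).

Definition loc_piece (d : D) : set Af :=
  [set x | exists k a, gr (d + e *+ k) a /\ x = frac f a k].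

Lemma loc_pieceW d a k l : gr (d + e *+ k) a ->
  gr (d + e *+ (k + l)) (hval f ^+ l * a).
Proof.
move=> da; rewrite mulrnDr addrA addrC.
by apply: pieceM => //; apply/pieceX/hvalP.
Qed.

Lemma loc_piece0 d : loc_piece d 0.
Proof. by exists 0%N, 0; split; [apply: piece0 | rewrite frac0]. Qed.

Lemma loc_pieceB d x y : loc_piece d x -> loc_piece d y -> loc_piece d (x - y).
Proof.
move=> [k [a [da ->]]] [l [b [db ->]]].
exists (k + l)%N, (hval f ^+ l * a - hval f ^+ k * b); split.
  by apply: pieceB; [|rewrite addnC]; apply: loc_pieceW.
by rewrite (frac_expand f a k l) (frac_expand f b l k) fracN [(l + k)%N]addnC fracDr.
Qed.

Lemma loc_pieceD d x y : loc_piece d x -> loc_piece d y -> loc_piece d (x + y).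
Proof.
move=> dx dy; rewrite -[y]opprK -[- y]add0r; apply: loc_pieceB => //.
by apply: loc_pieceB => //; apply: loc_piece0.
Qed.

Lemma loc_piece1 : loc_piece 0 1.
Proof. by exists 0%N, 1; rewrite addr0; split=> //; apply: piece1. Qed.

Lemma loc_pieceM d d' x y :
  loc_piece d x -> loc_piece d' y -> loc_piece (d + d') (x * y).
Proof.
move=> [k [a [da ->]]] [l [b [db ->]]]; exists (k + l)%N, (a * b).
by rewrite mulrnDr addrACA fracM; split=> //; apply: pieceM.
Qed.

Lemma frac_sum I (r : seq I) (F : I -> A) k :
  frac f (\sum_(i <- r) F i) k = \sum_(i <- r) frac f (F i) k.
Proof.
by rewrite (big_morph (fun a => frac f a k) (fun a b => esym (fracDr _ a b k))
  (frac0 _ k)).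
Qed.

Lemma loc_piece_span x : exists c : {malg Af[D]},
  (forall d, loc_piece d c@_d) /\ msum c = x.
Proof.
have [a [k ->]] := fracP x.
exists (\sum_(d <- msupp (coact gr a))
  << frac f (hcomp gr d a) k *g d - e *+ k >>); split=> [d|]; last first.
  rewrite msum_sum -[in RHS](msum_coact gr a) /msum frac_sum.
  by apply/eq_bigr=> d _; rewrite -/(msum _) msumU.
rewrite raddf_sum /=; elim/big_rec: _ => [|d' y _ yd]; first exact: loc_piece0.
apply: loc_pieceD => //; rewrite mcoeffU; case: eqP => [<-|_] /=.
  by exists k, (hcomp gr d' a); rewrite subrK; split=> //; apply: hcompP.
exact: loc_piece0.
Qed.

Lemma common_denom (c : D -> Af) (s : seq D) : (forall d, loc_piece d (c d)) ->
  exists k, forall d, d \in s -> exists a, gr (d + e *+ k) a /\ c d = frac f a k.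
Proof.
move=> cP; elim: s => [|d s [k IHs]]; first by exists 0%N.
have [l [b [db cd]]] := cP d; exists (l + k)%N => d'.
rewrite inE => /orP[/eqP ->|/IHs[a [da ->]]].
  by exists (hval f ^+ k * b); rewrite -frac_expand; split=> //; apply: loc_pieceW.
exists (hval f ^+ l * a); rewrite addnC -frac_expand; split=> //.
exact: loc_pieceW.
Qed.

Lemma loc_piece_direct (c : {malg Af[D]}) :
  (forall d, loc_piece d c@_d) -> msum c = 0 -> c = 0.
Proof.
move=> cP c0.
have [k kP] := common_denom (msupp c) cP.
have /choice[a aP] : forall d, exists a,
    d \in msupp c -> gr (d + e *+ k) a /\ c@_d = frac f a k.
  move=> d; case: (boolP (d \in msupp c)) => [/kP[a]|_]; first by exists a.
  by exists 0.
have : frac f (\sum_(d <- msupp c) a d) k = 0.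
  by rewrite -[RHS]c0 frac_sum; apply: eq_big_seq => d /aP[].
move=> /frac_eq0[l sum0].
pose b : {malg A[D]} :=
  \sum_(d <- msupp c) << hval f ^+ l * a d *g d + e *+ (k + l) >>.
have bE d : d \in msupp c -> b@_(d + e *+ (k + l)) = hval f ^+ l * a d.
  move=> dc; rewrite raddf_sum (big_fsetD1 d) //= mcoeffUU big1_fset ?addr0 //.
  move=> d' + _; rewrite in_fsetD1 => /andP[/eqP dd' _].
  by rewrite mcoeffU; case: eqP => // /addIr.
have b0 : b = 0.
  apply: (piece_direct (g := gr)) => [d|].
    rewrite raddf_sum big_seq; elim/big_rec: _ => [|d' y d'c yd].
      exact: piece0.
    apply: pieceD => //; apply: pieceU; apply: loc_pieceW.
    by have [] := aP _ d'c.
  rewrite msum_sum -[RHS]sum0 mulr_sumr; apply/eq_bigr=> d _.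
  by rewrite msumU.
apply/malgP=> d; rewrite mcoeff0.
case: (boolP (d \in msupp c)) => [dc|/mcoeff_outdom //].
have [_ ->] := aP d dc; apply/frac_eq0; exists l.
by rewrite -bE // b0 mcoeff0.
Qed.

Definition loc_grading : grading D Af :=
  Grading loc_piece0 loc_pieceB loc_piece1 loc_pieceM
    loc_piece_span loc_piece_direct.

Definition relevant : Prop := periodic loc_grading.

(* The ring A_(f). *)
Definition hloc : comPzRingType := deg0 loc_grading.

Definition hloc_val : {rmorphism hloc -> Af} :=
  (val : deg0 loc_grading -> Af).
End HomogeneousLocalization.
Arguments relevant {D A gr} f.

Section MultihomogeneousProj.
Variables (D : zmodType) (A : comPzRingType) (gr : grading D A).

(* Spec A[D] is the product of Spec A_0[D] and Spec A over Spec A_0; its two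
   maps to Spec A are the projection and the action. *)
Definition same_orbit (x y : Spec A) : Prop :=
  exists z : Spec (grpalg D A),
    x = Spec_map (@grpalgC D A) z /\ y = Spec_map (coact gr) z.

Definition orbit_eq (x y : Spec A) : bool :=
  `[< clos_refl_sym_trans (Spec A) same_orbit x y >].

Lemma orbit_eq_equiv : equiv_class_of orbit_eq.
Proof.
split=> [x|x y|y x z].
- by apply/asboolP/rst_refl.
- by apply/asboolP/asboolP; apply: rst_sym.
- by move=> /asboolP xy /asboolP yz; apply/asboolP; apply: rst_trans xy yz.
Qed.
Canonical orbit_eq_equiv_rel := EquivRelPack orbit_eq_equiv.

(* The points of the coequalizer, in ringed spaces, of the projection and the
   action; open subspaces of Q are determined by their sets of points. *)
Definition Q : Type := {eq_quot orbit_eq}.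
HB.instance Definition _ := Choice.on Q.
HB.instance Definition _ := EqQuotient.on Q.

(* [chart f p P] : the point p of Q lies in D_+(f) and corresponds there to
   the point P of Spec A_(f).  Both are images of a point of Spec A_f. *)
Definition chart (f : homog gr) (p : Q) (P : Spec (hloc f)) : Prop :=
  exists y : Spec (loc (hval f)),
    p = \pi_Q (Spec_map (@locmap A f) y) /\ P = Spec_map (hloc_val f) y.

Definition Dplus (f : homog gr) : set Q :=
  [set p | exists P : Spec (hloc f), chart p P].

Definition ProjMH : set Q := \bigcup_(f in relevant) Dplus f.

(* [in_point_ideal p d a] : a^n / g lies in P, where d is the degree of a,
   p in D_+(f) corresponds to P, and g (with inverse h) is a homogeneous unit of
   A_f of degree nd. *)
Definition in_point_ideal (p : Q) (d : D) (a : A) : Prop :=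
  exists (f : homog gr) (P : Spec (hloc f)) (n : nat) (g h : loc (hval f)),
    [/\ relevant f, chart p P, (0 < n)%N, loc_grading f (d *+ n) g & g * h = 1] /\
    exists2 x : hloc f, spec_ideal P x & hloc_val f x = locmap f a ^+ n * h.

(* The homogeneous ideal I_p. *)
Definition point_ideal (p : Q) : set A :=
  [set a | forall d, in_point_ideal p d (hcomp gr d a)].
End MultihomogeneousProj.
Arguments ProjMH {D A} gr _.

Definition zfree (D : zmodType) (s : seq D) : Prop :=
  forall c : 'I_(size s) -> int,
    \sum_(i < size s) s`_i *~ c i = 0 -> forall i, c i = 0.

Definition zspan (D : zmodType) (s : seq D) : Prop :=
  forall d : D, exists c : 'I_(size s) -> int,
    d = \sum_(i < size s) s`_i *~ c i.

Definition zbasis (D : zmodType) (s : seq D) : Prop := zfree s /\ zspan s.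

Definition free_of_rank (D : zmodType) (r : nat) : Prop :=
  exists2 s : seq D, zbasis s & size s = r.

(* A is generated, as an A_0-algebra, by the a_i. *)
Definition generated_over_deg0 (D : zmodType) (A : comPzRingType)
  (gr : grading D A) (n : nat) (a : 'I_n -> A) : Prop :=
  forall S : {pred A}, subring_closed S -> (forall x, gr 0 x -> x \in S) ->
    (forall i, a i \in S) -> forall x, x \in S.

(* Main.v *)
(* If a relevant f avoids a prime q of A, the degrees of the generators outside
   q generate a subgroup of finite index of D, hence contain a basis of D; the
   product of the corresponding generators also avoids q, and inverting it makes
   every degree the degree of a unit, so that products of this kind suffice to
   cover.  On such a chart the ideal of the point given by q consists of the
   elements all of whose components lie in q: it is the preimage under the
   coaction A -> A[D] of q[D], which is prime because D is torsion-free. *)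
Require Import Defs.
From HB Require Import structures.
From mathcomp Require Import all_boot all_order all_algebra.
From mathcomp Require Import finmap boolp classical_sets.
From mathcomp Require Import zify.
From mathcomp Require Import monalg.

Import Order.TTheory GRing.Theory Num.Theory.
Local Open Scope classical_set_scope.
Local Open Scope ring_scope.
Local Open Scope quotient_scope.

Set Implicit Arguments.
Unset Strict Implicit.
Unset Printing Implicit Defensive.

(** * Coordinates and integer characters of a free group of finite rank *)

Section Coordinates.
Variables (D : zmodType) (r : nat).

Lemma free_coordinates : free_of_rank D r ->
  exists c : {additive D -> 'rV[int]_r}, bijective c.
Proof.
move=> [s [s_free s_span] <-].
have [k kP] := choice s_span.
pose v (x : 'rV[int]_(size s)) : D := \sum_(i < size s) s`_i *~ x 0 i.
have v_add : zmod_morphism v.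
  move=> x y; rewrite /v -sumrB; apply: eq_bigr => i _.
  by rewrite !mxE mulrzBr.
pose c d : 'rV[int]_(size s) := \row_i k d i.
have cK : cancel c v.
  by move=> d; rewrite /v [RHS]kP; apply: eq_bigr => i _; rewrite mxE.
have v_inj x y : v x = v y -> x = y.
  move=> xy; apply/rowP => i.
  have /s_free/(_ i) : \sum_(i < size s) s`_i *~ (x 0 i - y 0 i) = 0.
    transitivity (v x - v y); last by rewrite xy subrr.
    by rewrite -v_add; apply: eq_bigr => j _; rewrite !mxE.
  by move/eqP; rewrite subr_eq0 => /eqP.
(* [k] is only a choice of coordinates; uniqueness of coordinates forces it to be additive. *)
have c_add : zmod_morphism c by move=> x y; apply: v_inj; rewrite v_add !cK.
pose cM := GRing.isZmodMorphism.Build _ _ c c_add.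
pose cA : {additive D -> 'rV[int]_(size s)} := HB.pack c cM.
by exists cA; exists v => // x; apply: v_inj; rewrite cK.
Qed.

(** With coordinates read as polynomial coefficients, evaluation at an integer is a character; the
    integer only has to avoid the roots of the nonzero polynomials coming from [l]. *)
Lemma separating_character : free_of_rank D r -> forall l : seq D,
  exists phi : {additive D -> int}, forall d, d \in l -> phi d = 0 -> d = 0.
Proof.
move=> /free_coordinates[c /bij_inj c_inj] l.
pose P d := rVpoly (c d).
have P0 d : P d = 0 -> d = 0.
  move=> Pd; apply: c_inj; rewrite raddf0 -[LHS]rVpolyK -/(P d) Pd.
  by rewrite raddf0.
pose R := \prod_(d <- l | d != 0) P d.
have R0 : R != 0.
  by rewrite prodf_seq_neq0; apply/allP => d _; apply/implyP/contra_neq/P0.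
(* The integers 0, ..., [size R] - 1 are one more than the degree of [R], so they are not all
   roots. *)
have [t Rt] : exists t : int, ~~ root R t.
  apply/not_existsP => all_root.
  have /(max_poly_roots R0) : all (root R) [seq i%:Z | i <- iota 0 (size R)].
    by apply/allP => t _; apply/negPn/negP/all_root.
  rewrite size_map size_iota ltnn => /(_ _)/negP; apply => //.
  by rewrite map_inj_uniq ?iota_uniq // => i j [].
have phi_add : zmod_morphism (fun d => (P d).[t]).
  by move=> d e; rewrite /P !raddfB hornerD hornerN.
pose phiM := GRing.isZmodMorphism.Build _ _ _ phi_add.
exists (HB.pack (fun d => (P d).[t]) phiM : {additive D -> int}) => d dl /= Pdt.
apply/eqP; apply: contraNT Rt => d0.
by rewrite /root /R horner_prod (big_rem d) //= d0 Pdt mul0r.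
Qed.
End Coordinates.

(** * The extension of a prime to the group algebra *)

Section CoefficientIdeal.
Variables (D : zmodType) (A : comPzRingType) (q : Spec A).

Lemma prime_ideal_sum I (s : seq I) (P : pred I) (F : I -> A) :
  (forall i, P i -> spec_ideal q (F i)) ->
  spec_ideal q (\sum_(i <- s | P i) F i).
Proof.
have [q0 qD _ _ _] := spec_prime q.
by move=> qF; elim/big_rec: _ => // i x /qF; apply: qD.
Qed.

Lemma prime_idealX x k : spec_ideal q (x ^+ k) -> spec_ideal q x.
Proof.
have [_ _ _ q1 qM] := spec_prime q.
by elim: k => [/q1 []|k IH]; rewrite exprS => /qM[].
Qed.

Lemma prime_idealMr x a : spec_ideal q x -> spec_ideal q (x * a).
Proof. by rewrite mulrC; exact: prime_idealMl (spec_prime q) _ _. Qed.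

Lemma prime_idealN x : spec_ideal q x -> spec_ideal q (- x).
Proof. by rewrite -mulN1r; exact: prime_idealMl (spec_prime q) _ _. Qed.

Lemma grpalg_coefM (u v : grpalg D A) (d : D) :
  mcoeff d (u * v) = \sum_(e <- msupp u) \sum_(e' <- msupp v)
    (mcoeff e u * mcoeff e' v) *+ (e + e' == d).
Proof.
rewrite {1}/GRing.mul /= /gmul raddf_sum; apply: eq_bigr => e _.
by rewrite raddf_sum; apply: eq_bigr => e' _; rewrite /= mcoeffU.
Qed.

(** Serves to pick leading exponents modulo a prime: [P] will say that the coefficient lies outside
    it. *)
Lemma argmax_seq (s : seq D) (phi : D -> int) (P : D -> Prop) d :
  d \in s -> P d ->
  exists2 m, P m & m \in s /\ forall e, e \in s -> P e -> (phi e <= phi m)%R.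
Proof.
elim: s d => // x s IH d; rewrite inE.
have [[m Pm [ms mmax]] _ _|no_s] :=
    pselect (exists2 m, P m & m \in s /\ forall e, e \in s -> P e -> (phi e <= phi m)%R).
  have [[Px xm]|x_le] := pselect (P x /\ (phi m <= phi x)%R).
    exists x => //; split=> [|e]; first exact: mem_head.
    by rewrite inE => /orP[/eqP-> //|es Pe]; apply: le_trans xm; apply: mmax.
  exists m => //; split=> [|e]; first by rewrite inE ms orbT.
  rewrite inE => /orP[/eqP-> Px|]; last exact: mmax.
  by rewrite leNgt; apply/negP => /ltW mx; apply: x_le.
move=> /orP[/eqP->|ds] Px; last by case: no_s; apply: IH ds Px.
exists x => //; split=> [|e]; first exact: mem_head.
by rewrite inE => /orP[/eqP-> //|es Pe]; case: no_s; apply: IH es Pe.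
Qed.

(* The leading coefficients of u and v, for a character injective on their
   supports, multiply to a coefficient of uv modulo q. *)
Lemma coefficient_ideal_prime r : free_of_rank D r ->
  is_prime_ideal [set u : grpalg D A | forall d, spec_ideal q (mcoeff d u)].
Proof.
move=> D_free; have [q0 qD qMl q1 qM] := spec_prime q.
split=> /= [d|u v qu qv d|u v qv d|/(_ 0)|u v quv].
- by rewrite mcoeff0.
- by rewrite mcoeffD; apply: qD.
- rewrite grpalg_coefM; apply: prime_ideal_sum => e _; apply: prime_ideal_sum => e' _.
  by case: eqP => _; rewrite ?mulr0n // mulr1n; apply: qMl.
- by rewrite /GRing.one /= mcoeffUU.
apply: contrapT => /not_orP[/existsNP[d0 ud0] /existsNP[e0 ve0]].
have supp w x : ~ spec_ideal q (mcoeff x w) -> x \in msupp (w : {malg A[D]}).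
  by move=> qx; apply/negPn/negP => /mcoeff_outdom wx; apply: qx; rewrite wx.
(* All differences of exponents: a character with no nonzero zero in [l] is injective on the two
   supports. *)
pose l := [seq x - y | x <- msupp u ++ msupp v, y <- msupp u ++ msupp v].
have [phi phi_sep] := separating_character D_free l.
have [d ud [du dmax]] := argmax_seq phi
    (P := fun x => ~ spec_ideal q (mcoeff x u)) (supp _ _ ud0) ud0.
have [e ve [ev emax]] := argmax_seq phi
    (P := fun x => ~ spec_ideal q (mcoeff x v)) (supp _ _ ve0) ve0.
have phi_inj x y : x \in msupp u ++ msupp v -> y \in msupp u ++ msupp v ->
    phi x = phi y -> x = y.
  move=> xs ys xy; apply/eqP; rewrite -subr_eq0; apply/eqP; apply: phi_sep.
    by apply/allpairsP; exists (x, y).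
  by rewrite raddfB xy subrr.
(* In the coefficient at [d + e] the term of the pair (d, e) is split off. Once the other terms are
   in [q], so is this one, against the choice of [d] and [e]. *)
have := quv (d + e); rewrite grpalg_coefM.
rewrite (bigD1_seq d du) ?fset_uniq //=.
rewrite (bigD1_seq e ev) ?fset_uniq //= eqxx mulr1n -addrA => quv_de.
suff /prime_idealN/(qD _ _ quv_de) : spec_ideal q
    (\sum_(y <- msupp v | y != e) (mcoeff d u * mcoeff y v) *+ (d + y == d + e)
     + \sum_(x <- msupp u | x != d) \sum_(y <- msupp v)
         (mcoeff x u * mcoeff y v) *+ (x + y == d + e)).
  by rewrite addrK => /qM[/ud|/ve].
apply: qD; first apply: prime_ideal_sum => y /negPf ye.
  by rewrite (inj_eq (addrI d)) ye mulr0n.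
apply: prime_ideal_sum => x /eqP xd; apply: prime_ideal_sum => y _.
case: eqP => [xy|_]; last by rewrite mulr0n.
rewrite mulr1n; have [qx|nqx] := pselect (spec_ideal q (mcoeff x u)).
  exact: prime_idealMr.
(* If both coefficients lie outside [q], maximality bounds [phi x] by [phi d] and [phi y] by
   [phi e]. The sums agree, so both are equalities and x = d. *)
have [qy|nqy] := pselect (spec_ideal q (mcoeff y v)); first exact: qMl.
have /(dmax _ (supp _ _ nqx)) phi_x := nqx.
have /(emax _ (supp _ _ nqy)) phi_y := nqy.
case: xd; apply: phi_inj; rewrite ?mem_cat ?du ?(supp _ _ nqx) //.
by move: (congr1 phi xy); rewrite !raddfD /=; lia.
Qed.
End CoefficientIdeal.

(** * Finite index and linear independence *)

(** By the pigeonhole principle two multiples of [d] share a representative in [s], and their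
    difference lies in [H]. *)
Lemma finite_index_multiple (D : zmodType) (H : set D) (d : D) :
  (forall x y, H x -> H y -> H (x - y)) -> finite_index H ->
  exists2 m, (0 < m)%N & H (d *+ m).
Proof.
move=> HB [s s_idx].
have /choice[rep repP] k : exists c, c \in s /\ H (d *+ k - c).
  by have [c cs Hc] := s_idx (d *+ k); exists c.
have [k [l [kl rep_kl]]] : exists k l, (k < l)%N /\ rep k = rep l.
  apply: contrapT => no_kl.
  have rep_inj : injective rep.
    move=> k l rep_kl; case: (ltngtP k l) => // kl; case: no_kl; last by exists l, k.
    by exists k, l.
  have : (size (map rep (iota 0 (size s).+1)) <= size s)%N.
    apply: uniq_leq_size; first by rewrite map_inj_uniq ?iota_uniq.
    by move=> _ /mapP[k _ ->]; case: (repP k).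
  by rewrite size_map size_iota ltnn.
exists (l - k)%N; first by rewrite subn_gt0.
rewrite mulrnBr ?(ltnW kl) //.
have [_ Hk] := repP k; have [_ Hl] := repP l.
by have := HB _ _ Hl Hk; rewrite rep_kl opprD opprK addrACA addNr addr0.
Qed.

Lemma zfree_map_enum (D : zmodType) r (F : 'I_r -> D) :
  (forall k : 'I_r -> int, \sum_(j < r) F j *~ k j = 0 -> forall j, k j = 0) ->
  zfree [seq F j | j <- enum 'I_r].
Proof.
move=> F_free c c0 i.
have e : size [seq F j | j <- enum 'I_r] = r by rewrite size_map size_enum_ord.
rewrite -(cast_ordK e i); move: (cast_ord e i) => {i}.
apply: F_free; rewrite -[RHS]c0 (reindex (cast_ord (esym e))) /=; last first.
  by exists (cast_ord e) => j _; rewrite ?cast_ordK ?cast_ordKV.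
apply: eq_bigr => j _.
by rewrite (nth_map j) ?size_enum_ord //= nth_ord_enum.
Qed.

(* Elements generating a subgroup of finite index span the rational vector
   space attached to D, so r of them are linearly independent. *)
Lemma independent_subfamily (D : zmodType) (r n : nat) (deg : 'I_n -> D)
    (P : set 'I_n) : free_of_rank D r ->
  (forall H : set D, H 0 -> (forall x y, H x -> H y -> H (x - y)) ->
     (forall i, P i -> H (deg i)) -> finite_index H) ->
  exists2 f : 'I_r -> 'I_n, forall j, P (f j) &
    injective (deg \o f) /\ zfree [seq deg (f j) | j <- enum 'I_r].
Proof.
move=> /free_coordinates[c [v cK vK]] P_idx.
pose cQ d : 'rV[rat]_r := map_mx intr (c d).
have cQB x y : cQ (x - y) = cQ x - cQ y by rewrite /cQ raddfB map_mxB.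
have cQ0 : cQ 0 = 0 by rewrite /cQ raddf0 map_mx0.
(* Rows with index outside [P] are set to zero, so that a family of independent rows only has
   indices in [P]. *)
pose M := \matrix_(i < n) if `[< P i >] then cQ (deg i) else 0.
pose H d : Prop := (cQ d <= M)%MS.
have HB x y : H x -> H y -> H (x - y).
  by rewrite /H cQB => Hx Hy; rewrite addmx_sub // eqmx_opp.
have H_idx : finite_index H.
  apply: P_idx => // [|i Pi]; first by rewrite /H cQ0 sub0mx.
  have MiE : cQ (deg i) = row i M by rewrite rowK asboolT.
  by rewrite /H MiE row_sub.
(* A positive multiple of each basis vector lies in the row space, and the factor can be divided out
   over the rationals. *)
have M_full : row_full M.
  rewrite -sub1mx; apply/row_subP => j; rewrite row1.
  have [m m_gt0] := finite_index_multiple (v (delta_mx 0 j)) HB H_idx.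
  have vjE : cQ (v (delta_mx 0 j) *+ m) = m%:R *: delta_mx 0 j.
    by rewrite /cQ raddfMn /= vK raddfMn /= map_delta_mx scaler_nat.
  by rewrite /H vjE eqmx_scale // pnatr_eq0 -lt0n.
pose f := fullrankfun M_full.
have N_free : row_free (rowsub f M).
  by rewrite row_free_unit -row_full_unit fullrowsub_full.
have Pf j : P (f j).
  apply/asboolP/negPn/negP => /negPf nP.
  have : row j (rowsub f M) = 0 by rewrite row_rowsub rowK nP.
  rewrite rowE => /eqP; rewrite mulmx_free_eq0 // => /eqP/rowP/(_ j).
  by rewrite !mxE !eqxx => /eqP; rewrite oner_eq0.
have row_f j : row j (rowsub f M) = cQ (deg (f j)).
  by rewrite row_rowsub rowK asboolT.
exists f => //; split=> [i j /= fij|].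
  have : row i (rowsub f M) = row j (rowsub f M) by rewrite !row_f fij.
  rewrite !rowE => /(row_free_inj N_free)/rowP/(_ i).
  by rewrite !mxE !eqxx eq_sym; case: eqP => // _ /eqP; rewrite oner_eq0.
apply: zfree_map_enum => k k0 j.
(* An integer relation among the degrees is a rational relation among independent rows. *)
have : (\row_j (k j)%:~R : 'rV[rat]_r) *m rowsub f M = 0.
  rewrite mulmx_sum_row -[RHS]cQ0 -k0 /cQ raddf_sum map_mx_sum.
  apply: eq_bigr => i _; rewrite row_f mxE /cQ raddfMz /=.
  by rewrite -scaler_int map_mxZ /= intz.
move=> /eqP; rewrite mulmx_free_eq0 // => /eqP/rowP/(_ j).
by rewrite !mxE => /eqP; rewrite intr_eq0 => /eqP.
Qed.

(** * Primes of a localization *)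

Lemma Spec_ext (R : comPzRingType) (x y : Spec R) :
  (forall a, spec_ideal x a <-> spec_ideal y a) -> x = y.
Proof.
case: x y => [x px] [y py] /= xy.
have {}xy : x = y by apply/funext => a; apply/propext.
by case: y / xy py => py; congr MkSpec; apply: Prop_irrelevance.
Qed.

(* [frac] is also a name of the library of fraction fields. *)
Local Notation frac := Defs.frac.

Section LocalizationPrimes.
Variables (A : comPzRingType) (f : A).

Lemma frac_self : locmap f f * frac f 1 1 = 1.
Proof.
rewrite fracM mulr1; apply/fracE; exists 0%N.
by rewrite !add0n expr0 mulr1 mul1r.
Qed.

Lemma fracE_locmap a k : frac f a k = locmap f a * frac f 1 1 ^+ k.
Proof.
have -> : frac f 1 1 ^+ k = frac f 1 k.
  by elim: k => [|k IH]; rewrite ?expr0 // exprS IH fracM mulr1.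
by rewrite fracM mulr1.
Qed.

Lemma prime_unit (R : comPzRingType) (y : Spec R) g h :
  g * h = 1 -> ~ spec_ideal y g.
Proof.
move=> gh yg; apply: (prime_ideal1 (spec_prime y)).
by rewrite -gh; apply: prime_idealMr.
Qed.

Lemma loc_prime_frac (y : Spec (loc f)) a k :
  spec_ideal y (frac f a k) <-> spec_ideal y (locmap f a).
Proof.
rewrite fracE_locmap; split=> [/(prime_idealM (spec_prime y))[] //|]; last first.
  exact: prime_idealMr.
move=> /prime_idealX yf; exfalso; move: yf; apply: (@prime_unit _ y _ (locmap f f)).
by rewrite mulrC frac_self.
Qed.

Lemma locmap_notin (y : Spec (loc f)) : ~ spec_ideal (Spec_map (locmap f) y) f.
Proof. exact: prime_unit frac_self. Qed.

(** The prime above [q] consists of the fractions with numerator in [q]. This does not depend on the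
    representative, since powers of [f] cancel modulo [q]. *)
Lemma Spec_map_locmap_surj (q : Spec A) : ~ spec_ideal q f ->
  exists y : Spec (loc f), Spec_map (locmap f) y = q.
Proof.
move=> qf; have [q0 qD qMl q1 qM] := spec_prime q.
have qX k a : spec_ideal q (f ^+ k * a) -> spec_ideal q a.
  by move=> /qM[/prime_idealX/qf|].
pose I : set (loc f) := [set x | exists a k, x = frac f a k /\ spec_ideal q a].
have IE a k : I (frac f a k) -> spec_ideal q a.
  move=> [b [l [/fracE[m e] qb]]]; apply: (@qX (m + l)%N).
  by rewrite e; apply: qMl.
have I_prime : is_prime_ideal I.
  split=> [|_ _ [a [k [-> qa]]] [b [l [-> qb]]]|x _ [a [k [-> qa]]]||x y].
  - by exists 0, 0%N; rewrite frac0.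
  - rewrite fracD; do 2!eexists; split; first by [].
    by apply: qD; apply: prime_idealMr.
  - have [b [l ->]] := fracP x; rewrite fracM; do 2!eexists; split; first by [].
    exact: qMl.
  - by move=> /IE.
  - have [a [k ->]] := fracP x; have [b [l ->]] := fracP y.
    by rewrite fracM => /IE/qM[qa|qb]; [left|right]; do 2!eexists; split.
exists (MkSpec I_prime); apply: Spec_ext => a; split=> [/IE //|qa].
by exists a, 0%N.
Qed.
End LocalizationPrimes.

(** * Points of the quotient, homogeneous units and point ideals *)

Section GradedPoints.
Variables (D : zmodType) (A : comPzRingType) (gr : grading D A).

Lemma hcomp_homog d a : gr d a -> hcomp gr d a = a.
Proof. by move=> da; rewrite /hcomp (coact_homog da) mcoeffUU. Qed.

(** The two maps send [a] to a X^0 and a X^d. Monomials X^e are units of A[D], so a prime contains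
    both images or neither. *)
Lemma same_orbit_homog (x y : Spec A) d a : same_orbit gr x y -> gr d a ->
  spec_ideal x a <-> spec_ideal y a.
Proof.
move=> [z [-> ->]] da; rewrite /= /preimage /= (coact_homog da) /grpalgC.
have shift e e' : spec_ideal z << a *g e >> -> spec_ideal z << a *g e' >>.
  pose t : grpalg D A := << (1 : A) *g e' - e >>.
  suff -> : << a *g e' >> = t * (<< a *g e >> : grpalg D A).
    exact: prime_idealMl (spec_prime z) _ _.
  by rewrite {1}/GRing.mul /= /t gmulUU mul1r subrK.
by split; apply: shift.
Qed.

Lemma Q_homog (x y : Spec A) d a : \pi_(Q gr) x = \pi_(Q gr) y -> gr d a ->
  spec_ideal x a <-> spec_ideal y a.
Proof.
move=> /eqquotP/asboolP xy da.
elim: xy => [{}x {}y xy|//|{}x {}y _ [] //|{}x {}y z _ [xy yx] _ [yz zy]].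
- exact: same_orbit_homog xy da.
- by split=> [/xy/yz|/zy/yx].
Qed.

Lemma DplusP (f : homog gr) (p : Q gr) :
  Dplus f p <-> exists2 q : Spec A, p = \pi_(Q gr) q & ~ spec_ideal q (hval f).
Proof.
split=> [[P [y [-> _]]]|[q -> /Spec_map_locmap_surj[y yq]]].
  by eexists; [reflexivity|exact: locmap_notin].
by eexists; exists y; rewrite yq.
Qed.

(* Unlike in [unit_degrees], the inverse is required to be homogeneous. *)
Definition homog_unit_degree (f : homog gr) (d : D) : Prop := exists g h,
  [/\ loc_grading f d g, loc_grading f (- d) h & g * h = 1].

Lemma homog_unit_degree0 f : homog_unit_degree f 0.
Proof. by exists 1, 1; rewrite oppr0 mulr1; split=> //; apply: piece1. Qed.

Lemma homog_unit_degreeB f d e : homog_unit_degree f d ->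
  homog_unit_degree f e -> homog_unit_degree f (d - e).
Proof.
move=> [g [h [dg dh gh]]] [g' [h' [dg' dh' gh']]].
exists (g * h'), (h * g'); split; first exact: pieceM.
  by rewrite opprB addrC; apply: pieceM.
by rewrite mulrACA gh mul1r mulrC.
Qed.

Lemma homog_unit_degree_sum f (s : seq D) (c : 'I_(size s) -> int) :
  (forall d, d \in s -> homog_unit_degree f d) ->
  homog_unit_degree f (\sum_(i < size s) s`_i *~ c i).
Proof.
move=> s_unit.
have unitN d : homog_unit_degree f d -> homog_unit_degree f (- d).
  by move=> /(homog_unit_degreeB (homog_unit_degree0 f)); rewrite sub0r.
have unitD d e : homog_unit_degree f d -> homog_unit_degree f e ->
    homog_unit_degree f (d + e).
  by move=> ud /unitN ue; rewrite -[e]opprK; apply: homog_unit_degreeB.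
have unitMn d k : homog_unit_degree f d -> homog_unit_degree f (d *+ k).
  move=> ud; elim: k => [|k IH]; first exact: homog_unit_degree0.
  by rewrite mulrS; apply: unitD.
elim/big_rec: _ => [|i x _]; first exact: homog_unit_degree0.
apply: unitD; have /s_unit ui : s`_i \in s by apply: mem_nth.
by case: (c i) => k; [|apply: unitN]; apply: unitMn.
Qed.

(** The inverse of [a] is b/f, homogeneous of degree -d. *)
Lemma homog_unit_degree_factor (f : homog gr) d e a b : hval f = a * b ->
  hdeg f = d + e -> gr d a -> gr e b -> homog_unit_degree f d.
Proof.
move=> fab fde da eb; exists (locmap f a), (frac f b 1); split.
- by exists 0%N, a; rewrite addr0.
- by exists 1%N, b; rewrite fde mulr1n addKr.
- rewrite fracM -fab -[RHS](frac_self (hval f)) [RHS]fracM.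
  by rewrite mulr1.
Qed.

Lemma unit_degrees_homog (f : homog gr) d :
  homog_unit_degree f d -> unit_degrees (loc_grading f) d.
Proof. by move=> [g [h [dg _ gh]]]; exists g; split=> //; exists h. Qed.

Lemma unit_degree_notin (f : homog gr) (y : Spec (loc (hval f))) d :
  unit_degrees (loc_grading f) d ->
  exists k b, gr (d + hdeg f *+ k) b /\ ~ spec_ideal (Spec_map (locmap f) y) b.
Proof.
move=> [_ [[k [b [db ->]]] [h bh]]]; exists k, b; split=> //.
by move=> /(loc_prime_frac y b k); apply: prime_unit bh.
Qed.

(** The chart may reach the point through a representative other than [q], but all representatives
    contain the same homogeneous elements. *)
Lemma in_point_idealP (q : Spec A) d a : gr d a ->
  in_point_ideal (\pi_(Q gr) q) d a -> spec_ideal q a.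
Proof.
move=> da [f [P [n [g [h [[_ [y [py ->]] n_gt0 dg gh] [x yx xE]]]]]]].
apply/(Q_homog py da).
have : spec_ideal y (hloc_val f x) := yx; rewrite xE.
move=> /(prime_idealM (spec_prime y))[/prime_idealX //|yh].
by exfalso; move: yh; apply: (@prime_unit _ y h g); rewrite mulrC.
Qed.

(** Since [d] itself is the degree of a unit, the exponent n = 1 works, and [a] times the inverse
    unit has degree 0. *)
Lemma mem_in_point_ideal (f : homog gr) (q : Spec A) d a : relevant f ->
  homog_unit_degree f d -> ~ spec_ideal q (hval f) -> gr d a ->
  spec_ideal q a -> in_point_ideal (\pi_(Q gr) q) d a.
Proof.
move=> f_rel [g [h [dg dh gh]]] /Spec_map_locmap_surj[y yq] da qa.
exists f, (Spec_map (hloc_val f) y), 1%N, g, h.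
split; first by split=> //; exists y; rewrite yq.
have ah0 : locmap f a * h \in in_deg0 (loc_grading f).
  apply/asboolP; rewrite -(subrr d); apply: pieceM dh.
  by exists 0%N, a; rewrite addr0.
exists (Deg0 ah0) => //=; apply: prime_idealMr.
by move: qa; rewrite -yq.
Qed.

Lemma coact_ideal_homogeneous (q : Spec A) :
  homogeneous_ideal gr [set a | forall d, spec_ideal q (hcomp gr d a)].
Proof.
move=> a /= qa d e; rewrite /hcomp (coact_homog (hcompP gr d a)) mcoeffU.
by case: eqP => _ /=; [apply: qa | apply: prime_ideal0 (spec_prime q)].
Qed.

(** The elements whose components of degree outside [H] all lie in [q] form a subring containing A_0
    and the generators. *)
Lemma generated_degree n (a : 'I_n -> A) (deg : 'I_n -> D) (H : set D)
    (q : Spec A) : generated_over_deg0 gr a -> (forall i, gr (deg i) (a i)) ->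
  H 0 -> (forall x y, H x -> H y -> H (x + y)) ->
  (forall i, ~ spec_ideal q (a i) -> H (deg i)) ->
  forall d x, gr d x -> ~ spec_ideal q x -> H d.
Proof.
move=> a_gen a_homog H0 HD H_deg.
have [q0 qD qMl q1 qM] := spec_prime q.
pose S x := forall d, spec_ideal q (hcomp gr d x) \/ H d.
have S_homog d x : gr d x -> spec_ideal q x \/ H d -> S x.
  move=> dx qHx e; rewrite /hcomp (coact_homog dx) mcoeffU.
  by case: eqP => [<-|_]; [rewrite mulr1n | left].
have S_closed : subring_closed (fun x => `[< S x >]).
  split=> [|x y /asboolP Sx /asboolP Sy|x y /asboolP Sx /asboolP Sy]; apply/asboolP.
  - by apply: (@S_homog 0); [apply: piece1 | right].
  - move=> d; rewrite /hcomp raddfB mcoeffB.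
    case: (Sx d) => [qx|]; last by right.
    case: (Sy d) => [qy|]; last by right.
    by left; apply: qD => //; apply: prime_idealN.
  (* When e + e' = d is outside [H], so is one of e and e', and the component in that degree lies in
     [q]. *)
  - move=> d; have [Hd|nHd] := pselect (H d); [by right|left].
    rewrite /hcomp rmorphM grpalg_coefM.
    apply: prime_ideal_sum => e _; apply: prime_ideal_sum => e' _.
    case: eqP => [ee'|_]; last by rewrite mulr0n.
    rewrite mulr1n; case: (Sx e) => [qx|He]; first exact: prime_idealMr.
    case: (Sy e') => [qy|He']; first exact: qMl.
    by case: nHd; rewrite -ee'; apply: HD.
move=> d x dx nqx.
have /asboolP/(_ d) : x \in (fun x => `[< S x >]).
  apply: (a_gen _ S_closed) => [x' dx'|i]; apply/asboolP.
    by apply: (S_homog _ _ dx'); right.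
  apply: S_homog (a_homog i) _.
  by have [?|/H_deg] := pselect (spec_ideal q (a i)); [left|right].
by rewrite hcomp_homog // => -[].
Qed.
End GradedPoints.

(** Charts are compared through a prime of A: as [q] avoids both elements, the point it represents
    lies in both charts. *)
Lemma relevant_refinement (D : zmodType) (r : nat) (A : comPzRingType)
    (gr : grading D A) (n : nat) (a : 'I_n -> A) (deg : 'I_n -> D)
    (f : homog gr) (q : Spec A) :
  free_of_rank D r -> (forall i, gr (deg i) (a i)) ->
  generated_over_deg0 gr a ->
  (forall s : seq D, {subset s <= codom deg} -> uniq s ->
     size s = r -> zfree s -> zbasis s) ->
  relevant f -> ~ spec_ideal q (hval f) ->
  exists2 f' : homog gr, forall d, homog_unit_degree f' d &
    ~ spec_ideal q (hval f').
Proof.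
move=> D_free a_homog a_gen deg_basis f_rel qf.
have [|s sP [s_inj s_free]] := @independent_subfamily _ _ _ deg
    [set i | ~ spec_ideal q (a i)] D_free.
  move=> H H0 HB H_deg.
  have HD x y : H x -> H y -> H (x + y).
    move=> Hx Hy; rewrite -[y]opprK; apply: (HB) => //.
    by rewrite -[- y]add0r; apply: HB.
  have HMn x k : H x -> H (x *+ k).
    by move=> Hx; elim: k => // k IH; rewrite mulrS; apply: HD.
  have H_gr := generated_degree a_gen a_homog H0 HD H_deg.
  have [y yq] := Spec_map_locmap_surj qf.
  (* The representatives for the unit degrees of [f] also serve for [H]: a unit b/f^k of degree d -
     c has [b] outside [q], and d - c is the degree of [b] minus k times that of [f]. *)
  have [t tP] := f_rel; exists t => d; have [c ct cu] := tP d; exists c => //.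
  have [k [b [db]]] := unit_degree_notin y cu.
  rewrite yq => nqb; rewrite -[d - c](addrK (hdeg f *+ k)).
  by apply: HB; [apply: H_gr db nqb | apply/HMn/(H_gr _ _ (hvalP f) qf)].
have [||||_ s_span] := deg_basis [seq deg (s j) | j <- enum 'I_r].
- by move=> _ /mapP[j _ ->]; apply: codom_f.
- by rewrite map_inj_uniq ?enum_uniq.
- by rewrite size_map size_enum_ord.
- exact: s_free.
have prod_gr (P : pred 'I_r) :
    gr (\sum_(j | P j) deg (s j)) (\prod_(j | P j) a (s j)).
  elim/big_rec2: _ => [|j x d _ dx]; first exact: piece1.
  exact: pieceM.
exists (Homog (prod_gr predT)) => [d|/=].
  have [c ->] := s_span d; apply: homog_unit_degree_sum => _ /mapP[j _ ->].
  (* The cofactor of the [j]-th generator is the product of the others. *)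
  apply: homog_unit_degree_factor (a_homog _) (prod_gr (predC1 j)) => /=.
    by rewrite (bigD1 j).
  by rewrite (bigD1 j).
elim/big_rec: _ => [|j x _ nqx]; first exact: prime_ideal1 (spec_prime q).
by move=> /(prime_idealM (spec_prime q))[/sP|].
Qed.

Theorem corollary1p7 (D : zmodType) (r : nat) (A : comPzRingType)
    (gr : grading D A) (n : nat) (a : 'I_n -> A) (deg : 'I_n -> D)
    (D_free : free_of_rank D r)
    (a_homog : forall i, gr (deg i) (a i))
    (a_gen : generated_over_deg0 gr a)
    (deg_basis : forall s : seq D, {subset s <= codom deg} -> uniq s ->
       size s = r -> zfree s -> zbasis s) :
  (exists F : set (homog gr),
     [/\ F `<=` relevant,
         ProjMH gr = \bigcup_(f in F) Dplus f
       & forall f, F f -> unit_degrees (loc_grading f) = setT]) /\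
  (forall p : Q gr, ProjMH gr p ->
     is_prime_ideal (point_ideal p) /\ homogeneous_ideal gr (point_ideal p)).
Proof.
(* [F] is given by the desired property; products of generators only enter to show that it
   covers. *)
pose F : set (homog gr) := [set f | forall d, homog_unit_degree f d].
have F_units f : F f -> unit_degrees (loc_grading f) = setT.
  by move=> Ff; apply/seteqP; split=> // d _; apply/unit_degrees_homog/Ff.
have F_rel f : F f -> relevant f.
  by move=> /F_units fT; exists [:: 0] => d; exists 0; rewrite ?mem_head // fT.
have cover p : ProjMH gr p -> exists2 f, F f &
    exists2 q : Spec A, p = \pi_(Q gr) q & ~ spec_ideal q (hval f).
  move=> [f f_rel /DplusP[q pq qf]].
  have [f' Ff' qf'] := relevant_refinement D_free a_homog a_gen deg_basis f_rel qf.
  by exists f' => //; exists q.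
split.
  exists F; split=> //; apply/seteqP; split=> [p /cover[f Ff qf]|p [f Ff fp]].
    by exists f => //; apply/DplusP.
  by exists f => //; apply: F_rel.
move=> p /cover[f Ff [q -> qf]].
(* One inclusion holds for any chart; the other uses that on the chart of [f] every degree is the
   degree of a homogeneous unit. *)
have -> : point_ideal (\pi_(Q gr) q) = [set x | forall d, spec_ideal q (hcomp gr d x)].
  apply/seteqP; split=> x /= px d; first exact: in_point_idealP (hcompP gr d x) (px d).
  exact: mem_in_point_ideal (F_rel _ Ff) (Ff d) qf (hcompP gr d x) (px d).
split; last exact: coact_ideal_homogeneous.
have q_prime := coefficient_ideal_prime q D_free.
exact: (preimage_prime_ideal (coact gr) (MkSpec q_prime)).
Qed.
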